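(* With the notation and hypotheses of the preceding setting (a P-closed set $\Omega$ with P-basis $\mathcal{A}$, pairwise non-conjugate $a^{(1)},\dots,a^{(\ell)}$ with $\mathcal{A}=\bigcup_i(\mathcal{A}\cap C(a^{(i)}))$, each $\mathcal{A}_i=\mathcal{A}\cap C(a^{(i)})=\{a^{(i)}_1,\dots,a^{(i)}_{n_i}\}$ non-empty, $a^{(i)}_j=\mathcal{D}_{a^{(i)}}(\alpha^{(i)}_j)(\alpha^{(i)}_j)^{-1}$, $n=n_1+\dots+n_\ell$, and $\phi_\mathcal{A}:\mathbb{F}^\mathcal{A}\to\mathbb{F}^n$ given by $\phi_\mathcal{A}(E_\mathcal{A}(F))=\big(F^{\mathcal{D}_{a^{(i)}}}(\alpha^{(i)}_j)\big)_{i,j}$ for $F\in\mathbb{F}[x;\sigma,\delta]_n$), let $K_i=K_{a^{(i)}}$. Then the function $\mathrm{wt}:\mathbb{F}^n\to\mathbb{N}$, $\mathrm{wt}(\phi_\mathcal{A}(f))=\mathrm{wt}_\mathcal{A}(f)$ for $f\in\mathbb{F}^\mathcal{A}$, equals the sum-rank weight on $\mathbb{F}^n$ with lengths $(n_1,\dots,n_\ell)$ and division subrings $(K_1,\dots,K_\ell)$.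
   Context: $\mathbb{F}$ is a division ring, $\sigma$ a ring endomorphism, $\delta$ a $\sigma$-derivation; $\mathbb{F}[x;\sigma,\delta]$ the skew polynomial ring ($xa=\sigma(a)x+\delta(a)$); evaluation $F(a)$ defined by $F-F(a)\in\mathbb{F}[x;\sigma,\delta](x-a)$, $E_\mathcal{A}(F)=(a\mapsto F(a))$. P-closure, P-closed, P-independent, P-basis and $\mathrm{Rk}$ as usual ($\overline\Omega$ = common zeros of all skew polynomials vanishing on $\Omega$; P-basis = P-independent subset with P-closure $\Omega$; $\mathrm{Rk}$ = size of a P-basis); $E_\mathcal{A}$ is a bijection from polynomials of degree $<n$ onto $\mathbb{F}^\mathcal{A}$, and $\phi_\mathcal{A}$ is a left linear isomorphism. Skew weight: $\mathrm{wt}_\mathcal{A}(E_\mathcal{A}(F))=n-\mathrm{Rk}(Z(F)\cap\Omega)$. $\mathcal{D}_a(b)=\sigma(b)a+\delta(b)$, $F^{\mathcal{D}_a}(b)=\sum_iF_i\mathcal{D}_a^i(b)$ for $F=\sum F_ix^i$, $K_a=\{b:\mathcal{D}_a(b)=ab\}$, $C(a)=\{\mathcal{D}_a(b)b^{-1}:b\neq0\}$. Sum-rank weight: for division subrings $K_1,\dots,K_\ell$ and $\mathbf{c}=(\mathbf{c}^{(1)},\dots,\mathbf{c}^{(\ell)})$ with $\mathbf{c}^{(i)}\in\mathbb{F}^{n_i}$, $\mathrm{wt_{SR}}(\mathbf{c})=\sum_i\dim_{K_i}\langle c^{(i)}_1,\dots,c^{(i)}_{n_i}\rangle^R_{K_i}$,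 where $\langle\cdot\rangle^R_{K}$ is the right $K$-span. *)

(* Defs.v *)
From HB Require Import structures.
From mathcomp Require Import all_boot all_order all_algebra.
From Stdlib Require Import ClassicalEpsilon.
Set Implicit Arguments.
Unset Strict Implicit.
Unset Printing Implicit Defensive.
Import GRing.Theory.
Local Open Scope ring_scope.

Section Skew.
Variables (R : unitRingType) (sigma : R -> R) (delta : R -> R).

(* Skew polynomials are represented by their coefficient lists in {poly R}
   (sum_i p`_i x^i, coefficients on the LEFT); only the additive structure
   of {poly R} is used, the multiplication is the skew one below. *)

(* left multiplication by x:  x * (sum_m d_m x^m) = sum_m (sigma d_m x + delta d_m) x^m *)
Definition xmul (p : {poly R}) : {poly R} :=
  map_poly sigma p * 'X + map_poly delta p.

Definition smul (p q : {poly R}) : {poly R} :=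
  \sum_(i < size p) p`_i *: iter i xmul q.

(* F(a) = 0  iff  F is in F[x;sigma,delta](x - a) *)
Definition svanish (p : {poly R}) (a : R) : Prop :=
  exists q : {poly R}, p = smul q ('X - a%:P).

Definition zeros (p : {poly R}) : R -> Prop := fun a => svanish p a.

Definition Pclosure (S : R -> Prop) : R -> Prop :=
  fun a => forall p : {poly R}, (forall s, S s -> svanish p s) -> svanish p a.

Definition Pclosed (S : R -> Prop) : Prop := forall a, Pclosure S a <-> S a.

Definition Pindep (B : R -> Prop) : Prop :=
  forall b, B b -> ~ Pclosure (fun x => B x /\ x <> b) b.

Definition Pbasis (S B : R -> Prop) : Prop :=
  (forall b, B b -> S b) /\ Pindep B /\ (forall a, Pclosure B a <-> S a).

Definition Rk (S : R -> Prop) : nat :=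
  size (epsilon (inhabits [::])
          (fun B : seq R => uniq B /\ Pbasis S (fun x => x \in B))).

Definition Dop (a b : R) : R := sigma b * a + delta b.

Definition Dpoly (p : {poly R}) (a b : R) : R :=
  \sum_(i < size p) p`_i * iter i (Dop a) b.

Definition Kset (a : R) : R -> Prop := fun b => Dop a b = a * b.

Definition Cls (a : R) : R -> Prop :=
  fun x => exists b, b != 0 /\ x = Dop a b * b^-1.

Definition Aelt (l : nat) (ns : 'I_l -> nat) (a : 'I_l -> R)
  (alpha : forall i, 'I_(ns i) -> R) (i : 'I_l) (j : 'I_(ns i)) : R :=
  Dop (a i) (alpha i j) * (alpha i j)^-1.

Definition Aset (l : nat) (ns : 'I_l -> nat) (a : 'I_l -> R)
  (alpha : forall i, 'I_(ns i) -> R) : R -> Prop :=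
  fun x => exists (i : 'I_l) (j : 'I_(ns i)), x = Dop (a i) (alpha i j) * (alpha i j)^-1.

End Skew.
Arguments Aelt {R} sigma delta {l ns} a alpha i j.

Section RightSpan.
Variable R : unitRingType.

Definition rcomb (vs lam : seq R) : R := \sum_(k < size vs) vs`_k * lam`_k.

Definition rspan (K : R -> Prop) (vs : seq R) : R -> Prop :=
  fun v => exists lam : seq R, size lam = size vs /\
    (forall k, (k < size lam)%N -> K lam`_k) /\ v = rcomb vs lam.

Definition rindep (K : R -> Prop) (B : seq R) : Prop :=
  forall lam : seq R, size lam = size B ->
    (forall k, (k < size lam)%N -> K lam`_k) -> rcomb B lam = 0 ->
    forall k, (k < size lam)%N -> lam`_k = 0.

Definition rbasis (K V : R -> Prop) (B : seq R) : Prop :=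
  (forall b, b \in B -> V b) /\ rindep K B /\ (forall v, V v -> rspan K B v).

Definition rdim (K V : R -> Prop) : nat :=
  size (epsilon (inhabits [::]) (rbasis K V)).

Definition wtSR (l : nat) (ns : 'I_l -> nat) (Ks : 'I_l -> R -> Prop)
  (c : forall i, 'I_(ns i) -> R) : nat :=
  (\sum_(i < l) rdim (Ks i) (rspan (Ks i) [seq c i j | j <- enum 'I_(ns i)]))%N.

End RightSpan.
Arguments wtSR {R l} ns Ks c.

(* Main.v *)
Require Import Defs.
From HB Require Import structures.
From mathcomp Require Import all_boot all_order all_algebra.
From Stdlib Require Import Classical ClassicalEpsilon.
(* Evaluation of F at D_a(b) b^-1 vanishes iff F^{D_a}(b) = 0, and b |-> F^{D_a}(b) is right
   K_a-linear.  Dividing by x - c shows that a nonzero F killing a K_{a_i}-independent list B_i for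
   each of the pairwise non-conjugate a_i has degree at least the total length of the B_i.  As some
   monic polynomial of degree |L| vanishes on any given finite list L, this bound identifies
   P-independence with right independence in each class, describes the P-closure, and also shows
   that Rk and the dimensions over K_a do not depend on the chosen bases.  The equality of the
   weights is then the rank-nullity theorem for each b |-> F^{D_{a_i}}(b) on the span of the
   alpha_{ij}. *)

Set Implicit Arguments.
Unset Strict Implicit.
Unset Printing Implicit Defensive.
Import GRing.Theory.
Local Open Scope ring_scope.

(** * Right linear algebra over a division subring *)

Section RightLinearAlgebra.
Variables (R : unitRingType) (hdiv : forall x : R, x != 0 -> x \is a GRing.unit).
Implicit Types (x y k v : R) (s B lam : seq R).

Lemma div_mulI x y : x != 0 -> x * y = 0 -> y = 0.
Proof. by move=> /hdiv ux h; apply: (mulrI ux); rewrite h mulr0. Qed.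

Lemma div_mulIr x y : y != 0 -> x * y = 0 -> x = 0.
Proof. by move=> /hdiv ux h; apply: (mulIr ux); rewrite h mul0r. Qed.

Definition division_subring (K : R -> Prop) : Prop :=
  [/\ K 1, forall x y, K x -> K y -> K (x - y),
      forall x y, K x -> K y -> K (x * y) &
      forall x, K x -> x != 0 -> K x^-1].

Definition rlinear (K : R -> Prop) (f : R -> R) : Prop :=
  (forall x y, f (x + y) = f x + f y) /\ (forall x k, K k -> f (x * k) = f x * k).

Lemma rcomb_cons x k s lam : rcomb (x :: s) (k :: lam) = x * k + rcomb s lam.
Proof. by rewrite /rcomb /= big_ord_recl. Qed.

Variable K : R -> Prop.
Hypothesis hK : division_subring K.

Lemma subring0 : K 0.
Proof. by case: hK => h1 hB _ _; rewrite -(subrr 1); apply: hB. Qed.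

Lemma subringN x : K x -> K (- x).
Proof. by case: hK => _ hB _ _ hx; rewrite -sub0r; apply: hB => //; apply: subring0. Qed.

Lemma rspan_nil v : rspan K [::] v <-> v = 0.
Proof.
split=> [[lam [_ [_ ->]]]|->]; first by rewrite /rcomb big_ord0.
by exists [::]; rewrite /rcomb big_ord0.
Qed.

Lemma rspan_cons x s v :
  rspan K (x :: s) v <-> exists2 k, K k & rspan K s (v - x * k).
Proof.
split=> [[[|k lam] [//= [sz] [hl ->]]]|[k kK [lam [sz [hl e]]]]].
  exists k; first exact: (hl 0%N).
  exists lam; rewrite rcomb_cons addrC addKr; do ?split=> //.
  by move=> i hi; apply: (hl i.+1).
exists (k :: lam); rewrite rcomb_cons /= sz -e addrC subrK; do ?split=> //.
by case=> [|i] //= hi; apply: hl; rewrite sz.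
Qed.

(** Serves twice: for transitivity of spans, and to show that an operator killing the generators
    kills their span. *)
Lemma rspan_subspace (W : R -> Prop) s v :
  W 0 -> (forall x y, W x -> W y -> W (x + y)) ->
  (forall x k, K k -> W x -> W (x * k)) ->
  (forall x, x \in s -> W x) -> rspan K s v -> W v.
Proof.
move=> W0 WD WM; elim: s v => [|x s IH] v Ws; first by move/rspan_nil->.
case/rspan_cons=> k kK h; rewrite -(subrK (x * k) v); apply: WD.
  by apply: IH h => y ys; apply: Ws; rewrite inE ys orbT.
by apply: WM => //; apply: Ws; rewrite mem_head.
Qed.

Lemma rspan0 s : rspan K s 0.
Proof.
elim: s => [|x s IH]; first exact/rspan_nil.
by apply/rspan_cons; exists 0; [apply: subring0|rewrite mulr0 subr0].
Qed.

Lemma rspanZ s v k : K k -> rspan K s v -> rspan K s (v * k).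
Proof.
case: hK => _ _ hM _ kK; elim: s v => [|x s IH] v.
  by move/rspan_nil->; rewrite mul0r; apply: rspan0.
case/rspan_cons=> k' k'K h; apply/rspan_cons; exists (k' * k); first exact: hM.
by rewrite mulrA -mulrBl; apply: IH.
Qed.

Lemma subringD x y : K x -> K y -> K (x + y).
Proof. by case: hK => _ hB _ _ hx /subringN hy; rewrite -(opprK y); apply: hB. Qed.

Lemma rspanD s v w : rspan K s v -> rspan K s w -> rspan K s (v + w).
Proof.
elim: s v w => [|x s IH] v w.
  by move=> /rspan_nil-> /rspan_nil->; rewrite addr0; apply: rspan0.
case/rspan_cons=> k kK h /rspan_cons[k' k'K h'].
apply/rspan_cons; exists (k + k'); first exact: subringD.
by rewrite mulrDr opprD addrACA; apply: IH.
Qed.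

Lemma rspanN s v : rspan K s v -> rspan K s (- v).
Proof.
move=> h; rewrite -mulrN1; apply: rspanZ h.
by apply: subringN; case: hK.
Qed.

Lemma rspan_consW x s v : rspan K s v -> rspan K (x :: s) v.
Proof.
by move=> h; apply/rspan_cons; exists 0; [apply: subring0|rewrite mulr0 subr0].
Qed.

Lemma rspan_mem s x : x \in s -> rspan K s x.
Proof.
elim: s => // y s IH; rewrite inE => /orP[/eqP->|/IH]; last exact: rspan_consW.
apply/rspan_cons; exists 1; first by case: hK.
by rewrite mulr1 subrr; apply: rspan0.
Qed.

Lemma rspan_trans s t v :
  (forall x, x \in s -> rspan K t x) -> rspan K s v -> rspan K t v.
Proof.
move=> h; apply: rspan_subspace => //; first exact: rspan0.
  by move=> x y; apply: rspanD.
by move=> x k; apply: rspanZ.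
Qed.

Lemma rindep_nil : rindep K [::].
Proof. by move=> lam -> _ _ k. Qed.

(** A nonzero coefficient at [x] in a relation could be inverted, which would put [x] into the span
    of [s]. This makes independence accessible to induction on the list. *)
Lemma rindep_cons x s : rindep K (x :: s) <-> ~ rspan K s x /\ rindep K s.
Proof.
case: (hK) => K1 _ _ KV; split=> [h|[hx hs]].
  split=> [/rspanN[lam [sz [hl e]]]|lam sz hl e k hk].
    have hl1 i : (i < size (1%R :: lam))%N -> K (1 :: lam)`_i by case: i => [|i] //; apply: hl.
    have := h (1 :: lam); rewrite rcomb_cons mulr1 -e subrr /= sz.
    move=> /(_ erefl); rewrite -sz => /(_ hl1 erefl 0%N isT) /= /eqP.
    by rewrite oner_eq0.
  have := h (0 :: lam); rewrite rcomb_cons mulr0 add0r /= sz.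
  move=> /(_ erefl _ e k.+1) /=; apply; last by rewrite ltnS -sz.
  by case=> [|i] hi; [apply: subring0|apply: hl; rewrite sz].
case=> [//|k lam] /= [sz] hl; rewrite rcomb_cons => e.
have hl' i : (i < size lam)%N -> K lam`_i by move=> hi; apply: (hl i.+1).
have sl : rspan K s (rcomb s lam) by exists lam.
have k0 : k = 0.
  apply/eqP/negP => /negP kn0; apply: hx.
  have -> : x = - rcomb s lam * k^-1.
    have /eqP := e; rewrite addr_eq0 => /eqP <-.
    by rewrite mulrK //; apply: hdiv.
  by apply: rspanZ; [apply: KV => //; apply: (hl 0%N)|apply: rspanN].
case=> [//|i] hi /=; apply: hs => //.
by rewrite k0 mulr0 add0r in e.
Qed.

Lemma rlinear0 f : rlinear K f -> f 0 = 0.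
Proof. by case=> fD _; apply: (addrI (f 0)); rewrite -fD !addr0. Qed.

Lemma rlinearB f x y : rlinear K f -> f (x - y) = f x - f y.
Proof. by case=> fD _; apply: (addIr (f y)); rewrite -fD !subrK. Qed.

Lemma rcomb_map f s lam : rlinear K f -> size lam = size s ->
  (forall k : nat, (k < size lam)%N -> K lam`_k) ->
  f (rcomb s lam) = rcomb (map f s) lam.
Proof.
move=> fL; have [fD fZ] := fL.
elim: s lam => [|x s IH] [|k lam] //=; first by rewrite /rcomb !big_ord0 rlinear0.
move=> [sz] hl; rewrite !rcomb_cons fD fZ; last exact: (hl 0%N).
by rewrite IH // => i hi; apply: (hl i.+1).
Qed.

Lemma rspan_map f s v : rlinear K f ->
  rspan K (map f s) v <-> exists2 w, rspan K s w & v = f w.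
Proof.
move=> fL; split=> [[lam [sz [hl ->]]]|[w [lam [sz [hl ->]]] ->]].
  rewrite size_map in sz; exists (rcomb s lam); first by exists lam.
  by rewrite rcomb_map.
by exists lam; rewrite size_map rcomb_map.
Qed.

Lemma rindep_map f s : rlinear K f -> rindep K s ->
  (forall v, rspan K s v -> f v = 0 -> v = 0) -> rindep K (map f s).
Proof.
move=> fL hs inj lam; rewrite size_map => sz hl.
rewrite -rcomb_map // => e; apply: hs => //.
by apply: inj => //; exists lam.
Qed.

Lemma rindep_neq0 s x : rindep K s -> x \in s -> x != 0.
Proof.
elim: s => // y s IH /rindep_cons[hy hs]; rewrite inE => /orP[/eqP->|]; last exact: IH.
by apply/negP => /eqP y0; apply: hy; rewrite y0; apply: rspan0.
Qed.

(** Induction on [s]. If [f x = f y] for some [y] in the span of the tail, then [x - y] joins the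
    kernel basis; otherwise [f x] joins the image basis. *)
Lemma rank_nullity f s : rlinear K f -> rindep K s -> exists b c,
  [/\ rbasis K (fun v => rspan K s v /\ f v = 0) b,
      rbasis K (rspan K (map f s)) c & size s = (size c + size b)%N].
Proof.
move=> fL; elim: s => [|x s IH].
  move=> _; exists [::], [::]; split=> //; split=> //; split; try exact: rindep_nil.
    by move=> v [].
  by [].
case/rindep_cons=> hx /IH[b [c [[bV [bI bS]] [cV [cI cS]] sz]]].
case: (classic (rspan K (map f s) (f x))) => hfx.
  have [y ys fxy] := (rspan_map s (f x) fL).1 hfx.
  have fxy0 : f (x - y) = 0 by rewrite rlinearB // fxy subrr.
  exists (x - y :: b), c; split; last by rewrite /= sz addnS.
    split=> [v|].
      rewrite inE => /orP[/eqP->|/bV[vs fv]]; last by split=> //; apply: rspan_consW.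
      split=> //; apply: rspanD; first by apply: rspan_mem; rewrite mem_head.
      by apply: rspanN; apply: rspan_consW.
    split=> [|v [/rspan_cons[k kK vk] fv]].
      apply/rindep_cons; split=> // h; apply: hx.
      rewrite -(subrK y x); apply: rspanD => //.
      by apply: rspan_trans h => z /bV[].
    apply/rspan_cons; exists k => //; apply: bS; split.
      by rewrite mulrBl opprB addrCA addrC; apply: rspanD => //; apply: rspanZ.
    by rewrite rlinearB // fv fL.2 // fxy0 mul0r subr0.
  split=> [v /cV|]; first exact: rspan_consW.
  split=> // v hv; apply: cS; apply: rspan_trans hv => z.
  by rewrite inE => /orP[/eqP->//|]; apply: rspan_mem.
exists b, (f x :: c); split; last by rewrite /= sz.
  split=> [v /bV[vs fv]|]; first by split=> //; apply: rspan_consW.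
  split=> // v [/rspan_cons[k kK vk] fv]; apply: bS.
  (* As [f v = 0], a nonzero [k] would express [f x] through the images of the tail. *)
  have k0 : k = 0.
    apply/eqP/negP => /negP kn0; apply: hfx.
    have -> : f x = f (- (v - x * k) * k^-1).
      case: hK => _ _ _ KV; rewrite fL.2; last exact: KV.
      by rewrite opprB rlinearB // fv subr0 fL.2 // mulrK //; apply: hdiv.
    apply/rspan_map=> //; exists (- (v - x * k) * k^-1) => //.
    by apply: rspanZ; [case: hK => _ _ _; apply|apply: rspanN].
  by split=> //; rewrite k0 mulr0 subr0 in vk.
split=> [v|].
  rewrite inE => /orP[/eqP->|/cV]; last exact: rspan_consW.
  by apply: rspan_mem; rewrite mem_head.
split=> [|v /rspan_cons[k kK vk]].
  apply/rindep_cons; split=> // h; apply: hfx.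
  by apply: rspan_trans h => z /cV.
by apply/rspan_cons; exists k => //; apply: cS.
Qed.

End RightLinearAlgebra.

(** * Skew multiplication and the operators F^{D_a} *)

Section SkewPolynomials.
Variables (R : unitRingType) (hdiv : forall x : R, x != 0 -> x \is a GRing.unit)
  (sigma : {rmorphism R -> R}) (delta : R -> R)
  (hdadd : forall x y : R, delta (x + y) = delta x + delta y)
  (hdmul : forall x y : R, delta (x * y) = sigma x * delta y + delta x * y).
Implicit Types (p q F G : {poly R}) (a b c : R) (L : seq R).

Local Notation xmul := (xmul sigma delta).
Local Notation smul := (smul sigma delta).
Local Notation svanish := (svanish sigma delta).
Local Notation Pclosure := (Pclosure sigma delta).
Local Notation Pindep := (Pindep sigma delta).
Local Notation Pbasis := (Pbasis sigma delta).
Local Notation Dop := (Dop sigma delta).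
Local Notation Dpoly := (Dpoly sigma delta).
Local Notation Kset := (Kset sigma delta).
Local Notation Cls := (Cls sigma delta).

Lemma sderiv0 : delta 0 = 0.
Proof. by apply: (addrI (delta 0)); rewrite -hdadd !addr0. Qed.

Lemma sderiv1 : delta 1 = 0.
Proof.
by have := hdmul 1 1; rewrite !mulr1 rmorph1 mul1r -[LHS]addr0 => /addrI.
Qed.

(** Common form of the skew product p q, where [f i] is x^i q, and of p^{D_a}(b), where [f i] is
    D_a^i(b); linearity in p is proved once for both. *)
Definition pcomb (V : lmodType R) (f : nat -> V) (p : {poly R}) : V :=
  \sum_(i < size p) p`_i *: f i.

Lemma pcombE n (V : lmodType R) (f : nat -> V) p :
  (size p <= n)%N -> pcomb f p = \sum_(i < n) p`_i *: f i.
Proof.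
move=> hn; rewrite /pcomb (big_ord_widen_cond _ xpredT (fun i => p`_i *: f i) hn).
rewrite big_mkcond; apply: eq_bigr => i _ /=; case: ifP => // /negbT.
by rewrite -leqNgt => /(nth_default 0)->; rewrite scale0r.
Qed.

Lemma pcomb_is_linear (V : lmodType R) (f : nat -> V) : linear (pcomb f).
Proof.
move=> c p q; pose n := maxn (size p) (size q).
have hp : (size p <= n)%N by apply: leq_maxl.
have hq : (size q <= n)%N by apply: leq_maxr.
have hc : (size (c *: p + q)%R <= n)%N.
  by rewrite (leq_trans (size_polyD _ _)) // geq_max hq (leq_trans (size_scale_leq _ _)).
rewrite (pcombE f hp) (pcombE f hq) (pcombE f hc) scaler_sumr -big_split.
by apply: eq_bigr => i _ /=; rewrite coefD coefZ scalerDl scalerA.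
Qed.
HB.instance Definition _ (V : lmodType R) (f : nat -> V) :=
  GRing.isLinear.Build R {poly R} V _ (pcomb f) (pcomb_is_linear f).

Lemma pcombC (V : lmodType R) (f : nat -> V) c : pcomb f c%:P = c *: f 0%N.
Proof.
by rewrite (pcombE f (size_polyC_leq1 c)) big_ord1 coefC.
Qed.

Lemma pcombXn (V : lmodType R) (f : nat -> V) n : pcomb f 'X^n = f n.
Proof.
rewrite /pcomb size_polyXn big_ord_recr big1 /= => [|i _].
  by rewrite coefXn eqxx scale1r add0r.
by rewrite coefXn ltn_eqF // scale0r.
Qed.

Lemma linear_pcomb (V W : lmodType R) (f : nat -> V) (g : V -> W) p :
  linear g -> g (pcomb f p) = pcomb (fun i => g (f i)) p.
Proof.
move=> gL; pose gl := GRing.isLinear.Build R V W _ g gL.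
pose g' : {linear V -> W} := HB.pack g gl.
rewrite -[g _]/(g' _) linear_sum; apply: eq_bigr => i _.
by rewrite linearZ.
Qed.

Lemma coef_xmul p i :
  (xmul p)`_i = (if i is j.+1 then sigma p`_j else 0) + delta p`_i.
Proof.
rewrite coefD coefMX [in X in _ + X]coef_map_id0 ?sderiv0 //.
by case: i => [|i] //=; rewrite coef_map_id0 // rmorph0.
Qed.

(* Both left multiplication by x and the operators D_a are such maps, whence the action of a
   product is the composition of the actions. *)
Definition pseudolinear (V : lmodType R) (T : V -> V) : Prop :=
  (forall u v, T (u + v) = T u + T v) /\
  (forall c v, T (c *: v) = sigma c *: T v + delta c *: v).

Lemma xmul_pseudolinear : pseudolinear xmul.
Proof.
split=> [p q|c p]; apply/polyP => i.
  rewrite coef_xmul [RHS]coefD !coef_xmul coefD hdadd addrACA; case: i => [|i].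
    by rewrite addr0.
  by rewrite coefD rmorphD.
rewrite coef_xmul [RHS]coefD !coefZ !coef_xmul hdmul mulrDr -addrA; case: i => [|i].
  by rewrite mulr0.
by rewrite coefZ rmorphM.
Qed.

Lemma Dop_pseudolinear a : @pseudolinear R^o (Dop a).
Proof.
split=> [x y|x y]; rewrite /Dop ?rmorphD ?mulrDl ?hdadd; first by rewrite addrACA.
by rewrite /GRing.scale /= rmorphM hdmul mulrDr mulrA addrA.
Qed.

Lemma pseudolinear0 (V : lmodType R) (T : V -> V) : pseudolinear T -> T 0 = 0.
Proof. by case=> TD _; apply: (addrI (T 0)); rewrite -TD !addr0. Qed.

(** The coefficients of x p are sigma(p_{i-1}) + delta(p_i). The rule T(c v) = sigma(c) T(v) +
    delta(c) v gives the same two sums, the first one shifted by one index. *)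
Lemma pcomb_xmul (V : lmodType R) (T : V -> V) v p : pseudolinear T ->
  pcomb (fun i => iter i T v) (xmul p) = T (pcomb (fun i => iter i T v) p).
Proof.
move=> hT; have [TD TZ] := hT; rewrite {2}/pcomb (big_morph T TD (pseudolinear0 hT)).
have sz : (size (xmul p) <= (size p).+1)%N.
  apply/leq_sizeP => -[|j] // hj.
  by rewrite coef_xmul !nth_default ?(ltnW hj) // rmorph0 sderiv0 addr0.
rewrite (pcombE _ sz); under [RHS]eq_bigr => i _ do rewrite TZ -iterS.
rewrite big_split /=.
have -> : \sum_(i < size p) delta p`_i *: iter i T v =
          \sum_(i < (size p).+1) delta p`_i *: iter i T v.
  by rewrite big_ord_recr /= nth_default // sderiv0 scale0r addr0.
under eq_bigr => i _ do rewrite coef_xmul scalerDl.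
by rewrite big_split /= big_ord_recl /= scale0r add0r.
Qed.

Lemma smulE p q : smul p q = pcomb (fun i => iter i xmul q) p.
Proof. by []. Qed.

Lemma DpolyE p a b : Dpoly p a b = @pcomb R^o (fun i => iter i (Dop a) b) p.
Proof. by []. Qed.

Lemma smulDl p q F : smul (p + q) F = smul p F + smul q F.
Proof. by rewrite !smulE linearD. Qed.

Lemma smulZl c p F : smul (c *: p) F = c *: smul p F.
Proof. by rewrite !smulE linearZ. Qed.

Lemma DpolyD p q a b : Dpoly (p + q) a b = Dpoly p a b + Dpoly q a b.
Proof. by rewrite !DpolyE linearD. Qed.

Lemma DpolyB p q a b : Dpoly (p - q) a b = Dpoly p a b - Dpoly q a b.
Proof. by rewrite !DpolyE linearB. Qed.

Lemma DpolyZ c p a b : Dpoly (c *: p) a b = c * Dpoly p a b.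
Proof. by rewrite !DpolyE linearZ. Qed.

Lemma Dpoly_xmul p a b : Dpoly (xmul p) a b = Dop a (Dpoly p a b).
Proof. by rewrite !DpolyE pcomb_xmul //; apply: Dop_pseudolinear. Qed.

Lemma DpolyC c a b : Dpoly c%:P a b = c * b.
Proof. by rewrite DpolyE pcombC. Qed.

Lemma Dpoly_XsubC c a b : Dpoly ('X - c%:P) a b = Dop a b - c * b.
Proof. by rewrite DpolyB DpolyC DpolyE -['X]expr1 pcombXn. Qed.

Lemma Dpoly_smul p q a b : Dpoly (smul p q) a b = Dpoly p a (Dpoly q a b).
Proof.
rewrite smulE (@linear_pcomb _ R^o _ (fun F => Dpoly F a b)); last first.
  by move=> c F G; rewrite DpolyD DpolyZ.
rewrite DpolyE; apply: eq_bigr => i _.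
suff -> : Dpoly (iter i xmul q) a b = iter i (Dop a) (Dpoly q a b) by [].
by elim: (nat_of_ord i) => //= m <-; rewrite -Dpoly_xmul.
Qed.

(** * The operators D_a and the division subrings K_a *)

Lemma Dop_mul a x b : Dop a (x * b) = sigma x * Dop a b + delta x * b.
Proof. exact: (Dop_pseudolinear a).2. Qed.

Lemma Dop_mulK a b k : Kset a k -> Dop a (b * k) = Dop a b * k.
Proof. by move=> hk; rewrite Dop_mul hk mulrDl !mulrA. Qed.

Lemma Dop1 a : Dop a 1 = a.
Proof. by rewrite /Dop rmorph1 mul1r sderiv1 addr0. Qed.

Lemma Dop0 a : Dop a 0 = 0.
Proof. exact: pseudolinear0 (Dop_pseudolinear a). Qed.

Lemma sigma_neq0 b : b != 0 -> sigma b != 0.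
Proof.
move=> /hdiv /(rmorph_unit sigma) u; apply/negP => /eqP s0.
by rewrite s0 unitr0 in u.
Qed.

(** Apply the product rule to v = b (b^-1 v) and cancel sigma(b). For a' = a this puts b^-1 v into
    K_a, and with v = 1, c = a it gives inverses in K_a; for v nonzero it exhibits a as a conjugate
    of a'. *)
Lemma Dop_conj a a' c b v : b != 0 -> Dop a b = c * b -> Dop a' v = c * v ->
  Dop a' (b^-1 * v) = a * (b^-1 * v).
Proof.
move=> b0 hb hv; have ub := hdiv b0.
apply/eqP; rewrite -subr_eq0; apply/eqP; apply: (div_mulI hdiv (sigma_neq0 b0)).
rewrite mulrBr; apply/eqP; rewrite subr_eq0; apply/eqP.
apply: (addIr (delta b * (b^-1 * v))); rewrite -Dop_mul mulVKr // hv.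
by rewrite (mulrA (sigma b)) -mulrDl -/(Dop a b) hb -mulrA mulVKr.
Qed.

Lemma Kset_division_subring a : division_subring (Kset a).
Proof.
have DB x y : Dop a (x - y) = Dop a x - Dop a y.
  by apply: (addIr (Dop a y)); rewrite -(Dop_pseudolinear a).1 !subrK.
split=> [|x y hx hy|x y hx hy|x hx x0]; rewrite /Kset.
- by rewrite Dop1 mulr1.
- by rewrite DB hx hy mulrBr.
- by rewrite Dop_mulK // hx mulrA.
by rewrite -[x^-1]mulr1; apply: (Dop_conj x0 hx); rewrite Dop1 mulr1.
Qed.

Lemma Dpoly_rlinear p a : rlinear (Kset a) (Dpoly p a).
Proof.
split=> [x y|x k hk]; rewrite /Dpoly.
  rewrite -big_split; apply: eq_bigr => i _; rewrite /= -mulrDr; congr (_ * _).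
  by elim: (nat_of_ord i) => //= m ->; rewrite (Dop_pseudolinear a).1.
rewrite mulr_suml; apply: eq_bigr => i _; rewrite -mulrA; congr (_ * _).
by elim: (nat_of_ord i) => //= m ->; rewrite Dop_mulK.
Qed.

Lemma Dpoly0 p a : Dpoly p a 0 = 0.
Proof. exact: rlinear0 (Dpoly_rlinear p a). Qed.

(** * Degrees, right division and evaluation *)

Lemma coef_neq0_lt_size p i : p`_i != 0 -> (i < size p)%N.
Proof. by apply: contra_neqT; rewrite -leqNgt => /(nth_default 0). Qed.

Lemma xmul_monic F : F \is monic -> xmul F \is monic /\ size (xmul F) = (size F).+1.
Proof.
move=> mF; have s0 : (0 < size F)%N by rewrite size_poly_gt0 monic_neq0.
have lF : (xmul F)`_(size F) = 1.
  rewrite coef_xmul (nth_default 0 (leqnn _)) sderiv0 addr0.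
  move: mF; rewrite monicE lead_coefE; case: (size F) s0 => // n _ /= /eqP->.
  by rewrite rmorph1.
have sz : size (xmul F) = (size F).+1.
  apply/eqP; rewrite eqn_leq; apply/andP; split.
    apply/leq_sizeP => -[|j] // hj.
    by rewrite coef_xmul !nth_default ?(ltnW hj) // rmorph0 sderiv0 addr0.
  by apply: coef_neq0_lt_size; rewrite lF oner_eq0.
by rewrite monicE lead_coefE sz /= lF.
Qed.

Lemma iter_xmul_monic F m : F \is monic ->
  iter m xmul F \is monic /\ size (iter m xmul F) = (m + size F)%N.
Proof.
by move=> mF; elim: m => //= m [h sz]; rewrite addSn -sz; apply: xmul_monic.
Qed.

(** As sigma(1) = 1 and delta(1) = 0, each x^m F is monic of degree m + deg F, so the leading
    coefficient of q survives in q F. *)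
Lemma size_smul q F : F \is monic -> q != 0 ->
  (size q + (size F).-1 <= size (smul q F))%N.
Proof.
move=> mF q0; have s0 : (0 < size F)%N by rewrite size_poly_gt0 monic_neq0.
have sq : (0 < size q)%N by rewrite size_poly_gt0.
have -> : (size q + (size F).-1 = ((size q).-1 + (size F).-1).+1)%N.
  by rewrite -addSn prednK.
apply: coef_neq0_lt_size; rewrite /Defs.smul coef_sum.
case E : (size q) sq => [//|n] _ /=.
rewrite big_ord_recr big1 /= => [|i _]; rewrite coefZ.
  have [mi si] := iter_xmul_monic n mF.
  have -> : (n + (size F).-1 = (size (iter n xmul F)).-1)%N.
    by rewrite si -subn1 -subn1 addnBA.
  rewrite -lead_coefE (monicP mi) mulr1 add0r.
  by rewrite -[n]/(n.+1.-1) -E -lead_coefE lead_coef_eq0.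
rewrite [X in _ * X]nth_default ?mulr0 //; have [_ ->] := iter_xmul_monic i mF.
by rewrite -[in leqLHS](prednK s0) addnS -addSn leq_add2r.
Qed.

Lemma smul_div F G : F \is monic ->
  exists q r, G = smul q F + r /\ (size r < size F)%N.
Proof.
move=> mF; have s0 : (0 < size F)%N by rewrite size_poly_gt0 monic_neq0.
have [n] := ubnP (size G); elim: n G => // n IH G; rewrite ltnS => hn.
case: (ltnP (size G) (size F)) => hs.
  by exists 0, G; rewrite smulE linear0 add0r.
(* With this [m], x^m F has size exactly [n], so a multiple of it clears the coefficient of index n
   - 1; if [G] is shorter than [n], that multiple is zero. *)
pose m := (n - size F)%N; have hm : (m + size F = n)%N by rewrite subnK // (leq_trans hs).
have [mi si] := iter_xmul_monic m mF; rewrite hm in si.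
have [|q [r [e hr]]] := IH (G - G`_n.-1 *: iter m xmul F).
  have n0 : (0 < n)%N by rewrite -hm addn_gt0 s0 orbT.
  rewrite -[X in (_ < X)%N](prednK n0) ltnS; apply/leq_sizeP => j.
  rewrite coefB coefZ leq_eqVlt => /orP[/eqP<-|hj].
    by move: (monicP mi); rewrite lead_coefE si => ->; rewrite mulr1 subrr.
  rewrite (prednK n0) in hj; rewrite (nth_default 0 (leq_trans hn hj)).
  by rewrite [X in _ - _ * X]nth_default ?si // mulr0 subr0.
exists (q + G`_n.-1 *: 'X^m), r; split=> //.
rewrite smulDl smulZl [smul 'X^m _]smulE pcombXn addrAC -e.
by rewrite subrK.
Qed.

(** Write p = q (x - c) + r with r constant. The factor x - c sends b to D_a(b) - c b = 0, so
    p^{D_a}(b) = r b, which vanishes exactly when r does. *)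
Lemma svanishP p a b c : b != 0 -> Dop a b = c * b ->
  svanish p c <-> Dpoly p a b = 0.
Proof.
move=> b0 hb; split=> [[q ->]|h].
  by rewrite Dpoly_smul Dpoly_XsubC hb subrr Dpoly0.
have [q [r [e sr]]] := smul_div p (monicXsubC c).
rewrite size_XsubC in sr; rewrite (size1_polyC sr) in e.
exists q; rewrite e; move: h; rewrite e DpolyD Dpoly_smul Dpoly_XsubC hb subrr Dpoly0 add0r DpolyC.
by move/(div_mulIr hdiv b0) ->; rewrite addr0.
Qed.

Lemma svanish1 p c : svanish p c <-> Dpoly p c 1 = 0.
Proof. by apply: svanishP; rewrite ?oner_eq0 // Dop1 mulr1. Qed.

Lemma svanish_point p a b : b != 0 ->
  svanish p (Dop a b * b^-1) <-> Dpoly p a b = 0.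
Proof. by move=> b0; apply: svanishP => //; rewrite mulrVK //; apply: hdiv. Qed.

(** Newton-style construction: multiplying F on the left by x - c' keeps the old zeros, and c' is c
    conjugated by the value F(c), so the new factor kills that value. *)
Lemma annihilator L : exists F,
  [/\ F \is monic, size F = (size L).+1 & forall c, c \in L -> svanish F c].
Proof.
elim: L => [|c L [F [mF sF hF]]].
  by exists 1; rewrite monic1 size_poly1; split.
pose e := Dpoly F c 1; pose c' := Dop c e * e^-1.
have he : Dop c e = c' * e.
  (* When F(c) = 0 the value of c' is immaterial, since D_c(0) = 0. *)
  have [e0|e0] := eqVneq e 0; first by rewrite e0 Dop0 mulr0.
  by rewrite /c' mulrVK //; apply: hdiv.
have [mx sx] := xmul_monic mF.
have hs : (size (- (c' *: F)) < size (xmul F))%N.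
  by rewrite sx ltnS size_polyN size_scale_leq.
exists (xmul F - c' *: F); split.
- by rewrite monicE lead_coefDl // (monicP mx).
- by rewrite size_polyDl // sx sF.
move=> d dL; apply/svanish1; rewrite DpolyB DpolyZ Dpoly_xmul.
move: dL; rewrite inE => /orP[/eqP->|/hF/svanish1->]; first by rewrite -/e he subrr.
by rewrite Dop0 mulr0 subr0.
Qed.

(** * P-independence and the rank *)

Lemma sub_Pindep (S T : R -> Prop) : (forall x, S x -> T x) -> Pindep T -> Pindep S.
Proof.
move=> ST hT b Sb h; apply: (hT b (ST b Sb)) => p hp.
by apply: h => s [Ss sb]; apply: hp; split=> //; apply: ST.
Qed.

(** In the induction step, the annihilator F of the tail right-divides everything vanishing on the
    tail, and F(c) is nonzero by P-independence; so a nonzero G vanishing at c as well is q F with q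
    not constant. *)
Lemma Pindep_lt_size L F : uniq L -> Pindep (fun x => x \in L) -> F != 0 ->
  (forall c, c \in L -> svanish F c) -> (size L < size F)%N.
Proof.
elim: L F => [|c L IH] G /=; first by rewrite size_poly_gt0.
case/andP=> cL uL hI G0 hG; have [F [mF sF hF]] := annihilator L.
have hI' : Pindep (fun x => x \in L).
  by apply: sub_Pindep hI => x xL; rewrite inE xL orbT.
have divF H : (forall d, d \in L -> svanish H d) -> exists q, H = smul q F.
  move=> hH; have [q [r [e sr]]] := smul_div H mF; exists q.
  (* A nonzero remainder would also vanish on [L], with degree below the length of [L]. *)
  have [r0|/IH h] := eqVneq r 0; first by rewrite e r0 addr0.
  have : (size L < size r)%N.
    apply: h => // d dL; apply/svanish1; have /svanish1 := hH d dL.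
    by rewrite e DpolyD Dpoly_smul (svanish1 F d).1 ?Dpoly0 ?add0r //; apply: hF.
  by rewrite ltnNge -ltnS -sF sr.
pose e := Dpoly F c 1.
(* Otherwise every multiple of F, hence everything vanishing on [L], would vanish at c. *)
have e0 : e != 0.
  apply/negP => /eqP Fc; apply: (hI c (mem_head _ _)) => H hH.
  have [d dL|q ->] := divF H.
    by apply: hH; rewrite inE dL orbT; split=> // dc; rewrite -dc dL in cL.
  by apply/svanish1; rewrite Dpoly_smul -/e Fc Dpoly0.
have [d dL|q eG] := divF G; first by apply: hG; rewrite inE dL orbT.
have q0 : q != 0 by apply: contra_neq G0 => q0; rewrite eG q0 smulE linear0.
apply: leq_trans (_ : size q + (size F).-1 <= _)%N; last first.
  by rewrite eG; apply: size_smul.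
rewrite sF /= -[X in (X <= _)%N]add2n leq_add2r ltnNge; apply/negP => sq.
have := hG c (mem_head _ _); rewrite svanish1 eG Dpoly_smul -/e.
rewrite (size1_polyC sq) DpolyC => /(div_mulIr hdiv e0) h.
by move: q0; rewrite (size1_polyC sq) h eqxx.
Qed.

(** A repetition in [L], or an element in the P-closure of the others, would let the annihilator of
    a shorter list vanish on all of [L]. *)
Lemma lt_size_Pindep L :
  (forall F, F != 0 -> (forall c, c \in L -> svanish F c) -> (size L < size F)%N) ->
  uniq L /\ Pindep (fun x => x \in L).
Proof.
move=> hL; split.
  apply: contraT; rewrite -ltn_size_undup ltnNge => /negP[].
  have [F [mF sF hF]] := annihilator (undup L).
  rewrite -ltnS -sF; apply: hL; first exact: monic_neq0.
  by move=> c cL; apply: hF; rewrite mem_undup.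
move=> c cL h; have [F [mF sF hF]] := annihilator (rem c L).
have : (size L < size F)%N.
  apply: hL => [|d dL]; first exact: monic_neq0.
  have hF' x : x \in L -> x <> c -> svanish F x.
    move=> xL /eqP xc; apply: hF; move: xL.
    by rewrite (perm_mem (perm_to_rem cL)) inE (negbTE xc).
  have [->|/eqP dc] := eqVneq d c; last exact: hF'.
  by apply: h => x [xL xc]; apply: hF'.
by rewrite sF size_rem // prednK ?ltnn //; case: (L) cL.
Qed.

(** The annihilator of one finite P-basis vanishes on any other, so the degree bound compares sizes
    both ways; this applies to the basis chosen by [epsilon]. *)
Lemma Rk_eq (S : R -> Prop) L :
  uniq L -> Pbasis S (fun x => x \in L) -> Rk sigma delta S = size L.
Proof.
have le (L1 L2 : seq R) : Pbasis S (fun x => x \in L1) ->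
    uniq L2 -> Pbasis S (fun x => x \in L2) -> (size L2 <= size L1)%N.
  move=> [_ [_ c1]] u2 [s2 [i2 _]]; have [F [mF sF hF]] := annihilator L1.
  rewrite -ltnS -sF; apply: Pindep_lt_size => //; first exact: monic_neq0.
  by move=> c /s2/c1; apply.
move=> uL bL; rewrite /Rk; set X := epsilon _ _.
have [uX bX] : uniq X /\ Pbasis S (fun x => x \in X).
  by apply: (epsilon_spec (inhabits [::])
    (fun B : seq R => uniq B /\ Pbasis S (fun x => x \in B))); exists L.
by apply/eqP; rewrite eqn_leq !le.
Qed.

Lemma Dpoly_rspan_eq0 F a (B : seq R) v : (forall b, b \in B -> Dpoly F a b = 0) ->
  rspan (Kset a) B v -> Dpoly F a v = 0.
Proof.
move=> hB; have [FD FZ] := Dpoly_rlinear F a.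
apply: (rspan_subspace (W := fun v => Dpoly F a v = 0)) => //.
- exact: Dpoly0.
- by move=> x y hx hy; rewrite FD hx hy addr0.
by move=> x k hk hx; rewrite FZ // hx mul0r.
Qed.

(** * Families of vectors at pairwise non-conjugate points *)

Section Families.
Variables (I : finType) (a : I -> R).
Hypothesis hnc : forall i k : I, i != k -> ~ Cls (a k) (a i).
Implicit Types (B : I -> seq R) (i k : I).

Let hK i : division_subring (Kset (a i)) := Kset_division_subring (a i).

Lemma Dop_eq_class c i k b (v : R) : b != 0 -> v != 0 ->
  Dop (a i) b = c * b -> Dop (a k) v = c * v ->
  i = k /\ Kset (a i) (b^-1 * v).
Proof.
move=> b0 v0 hb hv; have e := Dop_conj b0 hb hv.
have [ik|ik] := eqVneq i k; first by split=> //; rewrite /Defs.Kset {1}ik.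
(* For distinct indices, the nonzero vector b^-1 v would make a_i a conjugate of a_k. *)
have w0 : b^-1 * v != 0.
  by apply: contra_neq v0 => h; rewrite -[v](mulVKr (hdiv b0)) h mulr0.
case: (hnc ik); exists (b^-1 * v); split=> //.
by rewrite e mulrK //; apply: hdiv.
Qed.

Lemma rindep_map_XsubC B c i :
  (forall v, rspan (Kset (a i)) (B i) v -> Dop (a i) v = c * v -> v = 0) ->
  rindep (Kset (a i)) (B i) ->
  rindep (Kset (a i)) (map (Dpoly ('X - c%:P) (a i)) (B i)).
Proof.
move=> h hB; apply: rindep_map => //; first exact: Dpoly_rlinear.
move=> v vB; rewrite Dpoly_XsubC => /eqP; rewrite subr_eq0 => /eqP.
exact: h.
Qed.

(* Peel off one vector b: F = Q * (x - c) with c the point of b, and b |-> D(b) - c b is injective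
   on the span of the remaining vectors, so Q kills an independent family with one vector less. *)
Lemma rindep_lt_size F B : (forall i, rindep (Kset (a i)) (B i)) -> F != 0 ->
  (forall i b, b \in B i -> Dpoly F (a i) b = 0) ->
  (\sum_i size (B i) < size F)%N.
Proof.
move En : (\sum_i size (B i))%N => n.
elim: n F B En => [|n IH] F B En hB F0 hF; first by rewrite size_poly_gt0.
have [i Bi] : exists i, (0 < size (B i))%N.
  apply: NNPP => h; move: En; rewrite big1 // => i _.
  by case: (posnP (size (B i))) => // hi; case: h; exists i.
case EB : (B i) Bi => [//|b s] _.
have [bs sI] : ~ rspan (Kset (a i)) s b /\ rindep (Kset (a i)) s.
  by apply/(rindep_cons hdiv (hK i)); rewrite -EB.
have b0 : b != 0.
  by apply: (rindep_neq0 hdiv (hK i) (hB i)); rewrite EB mem_head.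
pose c := Dop (a i) b * b^-1.
have hb : Dop (a i) b = c * b by rewrite mulrVK //; apply: hdiv.
pose B0 k := if k == i then s else B k.
have B0sub k d : d \in B0 k -> d \in B k.
  rewrite /B0; case: eqP => [->|//] ds; by rewrite EB inE ds orbT.
have B0I k : rindep (Kset (a k)) (B0 k) by rewrite /B0; case: eqP => [->|].
(* A nonzero such v has the same index as b and b^-1 v in K, so b = v (b^-1 v)^-1 would lie in the
   span of [s]. *)
have inj k v : rspan (Kset (a k)) (B0 k) v -> Dop (a k) v = c * v -> v = 0.
  move=> vs hv; apply/eqP/negP => /negP v0.
  have [ik hk] := Dop_eq_class b0 v0 hb hv; subst k; apply: bs.
  have w0 : b^-1 * v != 0.
    by apply: contra_neq v0 => h; rewrite -[v](mulVKr (hdiv b0)) h mulr0.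
  have -> : b = v * (b^-1 * v)^-1.
    by rewrite -{1}[v](mulVKr (hdiv b0)) mulrK //; apply: hdiv.
  move: vs; rewrite /B0 eqxx => vs; apply: rspanZ => //.
  by case: (hK i) => _ _ _; apply.
have /(svanish_point F (a i) b0)[Q eF] : Dpoly F (a i) b = 0.
  by apply: hF; rewrite EB mem_head.
have Q0 : Q != 0 by apply: contra_neq F0 => Q0; rewrite eF Q0 smulE linear0.
apply: leq_trans (_ : size Q + (size ('X - c%:P)%R).-1 <= _)%N; last first.
  by rewrite eF; apply: size_smul => //; apply: monicXsubC.
rewrite size_XsubC addn1 ltnS.
apply: (IH _ (fun k => map (Dpoly ('X - c%:P) (a k)) (B0 k))) => //.
- move: En; rewrite (bigD1 i) //= EB /= addSn => -[<-].
  rewrite (bigD1 i) //= size_map {1}/B0 eqxx; congr (_ + _)%N.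
  by apply: eq_bigr => k /negbTE ki; rewrite size_map /B0 ki.
- by move=> k; apply: rindep_map_XsubC => // v; apply: inj.
move=> k _ /mapP[d dB ->]; rewrite -Dpoly_smul -eF; apply: hF; exact: B0sub.
Qed.

Definition points B : seq R := [seq Dop (a i) b * b^-1 | i <- enum I, b <- B i].

Lemma size_points B : size (points B) = (\sum_i size (B i))%N.
Proof. by rewrite size_allpairs_dep sumnE big_map big_enum. Qed.

Lemma svanish_points F B : (forall i, rindep (Kset (a i)) (B i)) ->
  (forall c, c \in points B -> svanish F c) <->
  (forall i b, b \in B i -> Dpoly F (a i) b = 0).
Proof.
move=> hB; have nz i b : b \in B i -> b != 0 by apply: (rindep_neq0 hdiv (hK i)).
split=> [h i b bB|h c /allpairsPdep[i [b [_ bB ->]]]].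
  apply/svanish_point; first exact: nz bB.
  by apply: h; apply/allpairsPdep; exists i, b; rewrite mem_enum.
by apply/svanish_point; [apply: nz bB|apply: h].
Qed.

(** A nonzero polynomial vanishing at these points kills all the vectors, so its degree is at least
    their number, and the degree criterion applies. *)
Lemma points_Pindep B : (forall i, rindep (Kset (a i)) (B i)) ->
  uniq (points B) /\ Pindep (fun x => x \in points B).
Proof.
move=> hB; apply: lt_size_Pindep => F F0 /svanish_points h.
by rewrite size_points; apply: rindep_lt_size => //; apply: h.
Qed.

(* If x - c were injective on all the spans, the quotient by x - c of a polynomial of degree
   |B| vanishing at the points of B would contradict [rindep_lt_size]. *)
Lemma Pclosure_points B c : (forall i, rindep (Kset (a i)) (B i)) ->
  Pclosure (fun x => x \in points B) c ->
  exists i v, [/\ v != 0, rspan (Kset (a i)) (B i) v & Dop (a i) v = c * v].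
Proof.
move=> hB hc; apply: NNPP => hn.
have inj i v : rspan (Kset (a i)) (B i) v -> Dop (a i) v = c * v -> v = 0.
  by move=> vs hv; apply/eqP/negP => /negP v0; apply: hn; exists i, v.
have [F [mF sF hF]] := annihilator (points B).
have [Q eF] := hc F hF.
have F0 := monic_neq0 mF.
have Q0 : Q != 0 by apply: contra_neq F0 => Q0; rewrite eF Q0 smulE linear0.
have := size_smul (monicXsubC c) Q0.
rewrite -eF sF size_XsubC addn1 ltnS leqNgt => /negP; apply.
rewrite size_points.
have /= := @rindep_lt_size Q (fun k => map (Dpoly ('X - c%:P) (a k)) (B k)).
under eq_bigr => k _ do rewrite size_map.
apply=> // [k|k _ /mapP[b bB ->]].
  by apply: rindep_map_XsubC => // v; apply: inj.
by rewrite -Dpoly_smul -eF; apply: (svanish_points F hB).1 bB.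
Qed.

End Families.

(** The annihilator of the points of one basis kills V, hence the other basis, and the degree bound
    for a single class compares their sizes. *)
Lemma rdim_eq a (V : R -> Prop) (B : seq R) : rbasis (Kset a) V B -> rdim (Kset a) V = size B.
Proof.
have hK := Kset_division_subring a.
have le (B1 B2 : seq R) : rbasis (Kset a) V B1 -> rbasis (Kset a) V B2 ->
    (size B2 <= size B1)%N.
  move=> [_ [i1 c1]] [s2 [i2 _]].
  (* Over a one-element index set non-conjugacy is vacuous. *)
  have hnc (i k : unit) : i != k -> ~ Cls a a by case: i; case: k.
  have [F [mF sF hF]] := annihilator (points (fun _ : unit => a) (fun=> B1)).
  have {}hF := (svanish_points F (a := fun=> a) (fun=> i1)).1 hF.
  have := @rindep_lt_size _ (fun=> a) hnc F (fun=> B2) (fun=> i2) (monic_neq0 mF).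
  rewrite sF size_points !sum_nat_const card_unit !mul1n ltnS; apply=> i b /s2/c1.
  by apply: Dpoly_rspan_eq0 => d; apply: hF.
move=> bB; rewrite /rdim; set X := epsilon _ _.
have bX : rbasis (Kset a) V X.
  by apply: (epsilon_spec (inhabits [::]) (rbasis (Kset a) V)); exists B.
by apply/eqP; rewrite eqn_leq !le.
Qed.

End SkewPolynomials.

(** * Comparison of the skew weight with the sum-rank weight *)

Theorem mainTheorem10 (R : unitRingType)
  (hdiv : forall x : R, x != 0 -> x \is a GRing.unit)
  (sigma : {rmorphism R -> R}) (delta : R -> R)
  (hdadd : forall x y : R, delta (x + y) = delta x + delta y)
  (hdmul : forall x y : R, delta (x * y) = sigma x * delta y + delta x * y)
  (Omega : R -> Prop) (hOmega : Pclosed sigma delta Omega)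
  (l : nat) (ns : 'I_l -> nat) (hns : forall i, (0 < ns i)%N)
  (a : 'I_l -> R)
  (hnc : forall i k : 'I_l, i != k -> ~ Cls sigma delta (a k) (a i))
  (alpha : forall i, 'I_(ns i) -> R) (halpha : forall i j, alpha i j != 0)
  (hinj : forall i, injective (Aelt sigma delta a alpha i))
  (hdisj : forall (i i' : 'I_l) (j : 'I_(ns i)) (j' : 'I_(ns i')),
      i != i' -> Aelt sigma delta a alpha i j <> Aelt sigma delta a alpha i' j')
  (hAi : forall i x, Aset sigma delta a alpha x -> Cls sigma delta (a i) x ->
      exists j, x = Aelt sigma delta a alpha i j)
  (hbasis : Pbasis sigma delta Omega (Aset sigma delta a alpha)) :
  forall P : {poly R}, (size P <= \sum_(i < l) ns i)%N ->
    ((\sum_(i < l) ns i) - Rk sigma delta (fun x => zeros sigma delta P x /\ Omega x))%N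
    = wtSR ns (fun i => Kset sigma delta (a i))
               (fun i j => Dpoly sigma delta P (a i) (alpha i j)).
Proof.
move=> P _.
pose K i := Kset sigma delta (a i).
have hK i : division_subring (K i) := Kset_division_subring hdiv hdadd hdmul (a i).
have DL F i : rlinear (K i) (Dpoly sigma delta F (a i)).
  exact: Dpoly_rlinear hdadd hdmul F (a i).
pose al i := [seq alpha i j | j <- enum 'I_(ns i)].
have sal i : size (al i) = ns i by rewrite size_map size_enum_ord.
have pointP F i b : b != 0 ->
    svanish sigma delta F (Dop sigma delta (a i) b * b^-1) <->
    Dpoly sigma delta F (a i) b = 0.
  by move=> b0; apply: svanish_point.
(* Apply to a relation the operator of any F vanishing at all points of the P-basis except the j-th:
   only the term of alpha_j survives, so F vanishes there too, against P-independence. *)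
have alI i : rindep (K i) (al i).
  move=> lam sz hl e m hm; apply/eqP/negP => /negP lm.
  have hm' : (m < ns i)%N by rewrite sz sal in hm.
  pose j := Ordinal hm'; have [_ [hI _]] := hbasis.
  apply: (hI (Aelt sigma delta a alpha i j)); first by exists i, j.
  move=> F hF; apply/pointP => //.
  apply: (div_mulIr hdiv lm).
  have := congr1 (Dpoly sigma delta F (a i)) e.
  rewrite (rcomb_map (DL F i) sz hl) (Dpoly0 hdadd hdmul) /rcomb.
  have sm : size (map (Dpoly sigma delta F (a i)) (al i)) = ns i.
    by rewrite size_map sal.
  have nth_al (k : 'I_(ns i)) :
      (map (Dpoly sigma delta F (a i)) (al i))`_k = Dpoly sigma delta F (a i) (alpha i k).
    by rewrite -map_comp (nth_map k) ?size_enum_ord // nth_ord_enum.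
  rewrite sm (bigD1 j) // big1 => [|k kj]; first by rewrite /= addr0 (nth_al j).
  rewrite nth_al.
  rewrite ((pointP F i (alpha i k) (halpha i k)).1 _) ?mul0r //.
  apply: hF; split; first by exists i, k.
  by move=> /hinj kj'; rewrite kj' eqxx in kj.
have alP x : Aset sigma delta a alpha x <-> x \in points sigma delta a al.
  split=> [[i [j ->]]|/allpairsPdep[i [b [_ /mapP[j _ ->] ->]]]]; last by exists i, j.
  by apply/allpairsPdep; exists i, (alpha i j); rewrite mem_enum map_f ?mem_enum.
have [_ [_ clA]] := hbasis.
(* For each class, [bc.1] is a basis of the kernel of P^{D_{a_i}} on the span of the alpha's and
   [bc.2] one of its image; the image dimensions are the summands of the sum-rank weight. *)
have : forall i, exists bc : seq R * seq R,
    [/\ rbasis (K i) (fun v => rspan (K i) (al i) v /\ Dpoly sigma delta P (a i) v = 0) bc.1,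
        rbasis (K i) (rspan (K i) (map (Dpoly sigma delta P (a i)) (al i))) bc.2 &
        size (al i) = (size bc.2 + size bc.1)%N].
  move=> i; have [b [c h]] := rank_nullity hdiv (hK i) (DL P i) (alI i).
  by exists (b, c).
move=> /fin_all_exists[bc hbc].
pose be i := (bc i).1.
have beI i : rindep (K i) (be i) by have [[_ []]] := hbc i.
have beV i b : b \in be i -> rspan (K i) (al i) b /\ Dpoly sigma delta P (a i) b = 0.
  by have [[h _] _ _] := hbc i; apply: h.
have vanish_al F : (forall x, Aset sigma delta a alpha x -> svanish sigma delta F x) ->
    forall i b, rspan (K i) (al i) b -> Dpoly sigma delta F (a i) b = 0.
  move=> hF i b; apply: Dpoly_rspan_eq0 => // _ /mapP[j _ ->].
  by apply/pointP => //; apply: hF; exists i, j.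
have [uL iL] := points_Pindep hdiv hdadd hdmul hnc beI.
have LS x : x \in points sigma delta a be -> zeros sigma delta P x /\ Omega x.
  move=> /allpairsPdep[i [b [_ hb ->]]]; have [bs Pb] := beV i b hb.
  have b0 := rindep_neq0 hdiv (hK i) (beI i) hb.
  split; first exact/pointP.
  by apply/clA => F hF; apply/pointP => //; apply: vanish_al hF _ _ bs.
(* The points of the kernel bases will be the P-basis that computes the skew weight. *)
have bL : Pbasis sigma delta (fun x => zeros sigma delta P x /\ Omega x)
    (fun x => x \in points sigma delta a be).
  split; first exact: LS.
  split=> // c; split=> [hc|[Pc Oc]].
    split; first by apply: hc => x /LS[].
    by apply/hOmega => F hF; apply: hc => x /LS[_ /hF].
  (* A common point of Z(P) and Omega comes from a vector v in the span of some alpha's. As P kills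
     v, it lies in the span of the kernel basis, so whatever vanishes at the points of that basis
     kills v. *)
  have cA : Pclosure sigma delta (fun x => x \in points sigma delta a al) c.
    by move=> F hF; apply: ((clA c).2 Oc) => x /alP; apply: hF.
  have [i [v [v0 vs hv]]] := Pclosure_points hdiv hdadd hdmul hnc alI cA.
  have vb : rspan (K i) (be i) v.
    have [[_ [_ h]] _ _] := hbc i; apply: h; split=> //.
    exact/(svanishP hdiv hdadd hdmul P v0 hv).
  move=> F hF; apply/(svanishP hdiv hdadd hdmul F v0 hv).
  apply: Dpoly_rspan_eq0 vb => //.
  exact: (svanish_points hdiv hdadd hdmul F beI).1 hF i.
rewrite (Rk_eq hdiv hdadd hdmul uL bL) size_points /wtSR.
(* The kernel dimensions cancel against the rank, leaving the image dimensions. *)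
have -> : (\sum_(i < l) ns i = \sum_(i < l) size (bc i).2 + \sum_(i < l) size (be i))%N.
  rewrite -big_split; apply: eq_bigr => i _; have [_ _ e] := hbc i.
  by rewrite -(sal i) e.
rewrite addnK; apply: eq_bigr => i _; have [_ h _] := hbc i.
by rewrite -(rdim_eq hdiv hdadd hdmul h) /al -map_comp.
Qed.
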